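(* Let $\mathbb{C}$ be a standard Cauchy random variable and define $$V_1=\frac{1}{1+\mathbb{C}},\qquad V_{n+1}=\frac{1}{1+V_n},\quad n\ge 1.$$ Then for every $n\ge 1$ the random variable $V_n$ has a Cauchy distribution with some scale parameter $a_n$ and location parameter $b_n$, and these parameters satisfy the recursive relationships $$a_{n+1}=\frac{a_n}{(1+b_n)^2+a_n^2},\qquad b_{n+1}=\frac{b_n+1}{(1+b_n)^2+a_n^2},\qquad n=1,2,\dots$$
   Context: A Cauchy random variable with scale parameter $a>0$ and location parameter $b\in\mathbb{R}$ has density $\frac{1}{\pi}\frac{a}{(x-b)^2+a^2}$, $x\in\mathbb{R}$. It is standard if $a=1$ and $b=0$. The variables $V_n$ are the finite continued fractions $V_n=\frac{1}{1+\frac{1}{1+\cdots\frac{1}{1+\mathbb{C}}}}$ with $n$ levels and are defined almost surely. *)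

(* Defs.v *)
From HB Require Import structures.
From mathcomp Require Import all_boot all_order all_algebra.
From mathcomp Require Import all_classical all_reals all_analysis.
Set Implicit Arguments.
Unset Strict Implicit.
Unset Printing Implicit Defensive.
Import Order.TTheory GRing.Theory Num.Theory.
Import numFieldNormedType.Exports.
Local Open Scope classical_set_scope.
Local Open Scope ring_scope.

(* [a] is the scale and [b] the location. *)
Definition cauchy_pdf (R : realType) (a b x : R) : R :=
  pi^-1 * (a / ((x - b) ^+ 2 + a ^+ 2)).

Definition cauchy_distributed d (T : measurableType d) (R : realType)
    (P : probability T R) (X : {RV P >-> R}) (a b : R) : Prop :=
  0 < a /\
  forall A : set R, measurable A ->
    distribution P X A =
      (\int[lebesgue_measure]_(x in A) (cauchy_pdf a b x)%:E)%E.

(* The variables are only defined almost surely: [1 / (1 + V n)] is imposed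
   almost surely and only where its denominator does not vanish, so the value
   0^-1 = 0 plays no role. Indices start at 1; [V 0] is unconstrained. *)
Definition continued_fraction_rv d (T : measurableType d) (R : realType)
    (P : probability T R) (C : {RV P >-> R}) (V : nat -> {RV P >-> R}) : Prop :=
  {ae P, forall w, 1 + C w != 0 -> V 1%N w = 1 / (1 + C w)} /\
  forall n, (1 <= n)%N ->
    {ae P, forall w, 1 + V n w != 0 -> V n.+1 w = 1 / (1 + V n w)}.

(* Main.v *)
(* If X is Cauchy with scale a and location b, then P(X = -1) = 0, and the
   substitution x = 1/y - 1 turns the density of X into that of 1 / (1 + X),
   which is again a Cauchy density. Since the substitution has a pole at y = 0,
   the two laws are only compared on the closed intervals avoiding 0 and on {0}
   itself; these form a pi-system generating the Borel sets. *)

Require Import Defs.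
From HB Require Import structures.
From mathcomp Require Import all_boot all_order all_algebra.
From mathcomp Require Import all_classical all_reals all_analysis.
From mathcomp Require Import measurable_realfun ring zify.
Import Order.TTheory GRing.Theory Num.Theory.
Import numFieldNormedType.Exports.
Local Open Scope classical_set_scope.
Local Open Scope ring_scope.

(** * Measures with a density, and uniqueness from intervals avoiding 0 *)

(** Bundles the integral of a density as a measure, so that uniqueness of measures can be applied to
    it; sigma-additivity is additivity of the integral over disjoint unions. *)
Lemma lebesgue_density_measure_ex (R : realType) (f : R -> \bar R) :
  measurable_fun [set: R] f -> (forall x, (0 <= f x)%E) ->
  exists m : {measure set R -> \bar R},
    forall A : set R, m A = (\int[lebesgue_measure]_(x in A) f x)%E.
Proof.
move=> mf f0.
pose m (A : set R) := (\int[lebesgue_measure]_(x in A) f x)%E.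
have m0 : m set0 = 0%E by rewrite /m integral_set0.
have m_ge0 (A : set R) : (0 <= m A)%E by exact: integral_ge0.
have m_sadd : semi_sigma_additive m.
  move=> A mA tA mUA; rewrite /m ge0_integral_bigcup//.
  - by apply: is_cvg_ereal_nneg_natsum_cond => n _ _; exact: integral_ge0.
  - exact: measurable_funTS.
by exists (HB.pack_for {measure set R -> \bar R} m
  (isMeasure.Build _ _ _ m m0 m_ge0 m_sadd)).
Qed.

(** Uniqueness of measures on a pi-system also asks for a countable cover by members of finite
    measure: [g] is the cover, and finiteness of [m1] bounds each [g k]. *)
Lemma eq_measure_itv_off0 (R : realType) (m1 m2 : {measure set R -> \bar R}) :
  (m1 [set: R] < +oo)%E -> m1 [set 0] = m2 [set 0] ->
  (forall u v, 0 < u \/ v < 0 -> m1 `[u, v]%classic = m2 `[u, v]%classic) ->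
  forall A, measurable A -> m1 A = m2 A.
Proof.
move=> m1oo m12_0 m12.
(* The third disjunct covers {0} and the empty set, which closes [G] under
   intersection. *)
pose G : set (set R) := [set A | exists u v,
  A = `[u, v]%classic /\ (0 < u \/ v < 0 \/ (0 <= u /\ v <= 0))].
(* Index 0 gives {0}; odd indices exhaust the positive half-line and even nonzero ones the negative
   half-line. *)
pose g k : set R := if k is k'.+1 then
    if odd k then `[k%:R^-1, k%:R]%classic else `[- k%:R, - k%:R^-1]%classic
  else `[0, 0]%classic.
have capE (u v u' v' : R) :
    `[u, v]%classic `&` `[u', v']%classic =
    `[Num.max u u', Num.min v v']%classic.
  apply/seteqP; split=> x /=; rewrite !in_itv /= ge_max le_min.
    by move=> [/andP[-> ->] /andP[-> ->]].
  by move=> /andP[/andP[-> ->] /andP[-> ->]].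
have Gg k : G (g k).
  case: k => [|k]; first by exists 0, 0; split => //; right; right.
  rewrite /g; case: ifP => _.
    by exists k.+1%:R^-1, k.+1%:R; split => //; left; rewrite invr_gt0.
  exists (- k.+1%:R), (- k.+1%:R^-1); split => //; right; left.
  by rewrite oppr_lt0 invr_gt0.
have gT : \bigcup_k g k = setT.
  apply/seteqP; split => // x _.
  have [->|x0] := eqVneq x 0.
    by exists 0%N => //=; rewrite in_itv /= lexx.
  have x0' : 0 < `|x| by rewrite normr_gt0.
  (* Every [k >= n] exceeds both [|x|] and its inverse; [n.*2.+1] and [n.*2.+2] are such [k] of each
     parity. *)
  pose n := (Num.truncn `|x| + Num.truncn `|x|^-1).+1.
  have hn k : (n <= k)%N -> k%:R^-1 <= `|x| <= k%:R.
    move=> nk; have k0 : (0 < k)%N by exact: leq_trans nk.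
    have h1 : `|x| <= k%:R.
      apply: (le_trans (ltW (truncnS_gt `|x|))); rewrite ler_nat.
      by apply: leq_trans nk; rewrite ltnS leq_addr.
    have h2 : `|x|^-1 <= k%:R.
      apply: (le_trans (ltW (truncnS_gt `|x|^-1))); rewrite ler_nat.
      by apply: leq_trans nk; rewrite ltnS leq_addl.
    by rewrite h1 andbT -[leRHS]invrK lef_pV2 ?posrE ?invr_gt0 ?ltr0n.
  have [xp|xn] := ltrP 0 x.
    exists (n.*2.+1) => //; rewrite /g oddS odd_double /= in_itv /=.
    have := hn n.*2.+1; rewrite (gtr0_norm xp); apply.
    by rewrite -addnn; lia.
  have {}xn : x < 0 by rewrite lt_neqAle x0.
  exists (n.*2.+2) => //; rewrite /g oddS oddS odd_double /= in_itv /=.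
  have := hn n.*2.+2; rewrite (ltr0_norm xn) => /(_ _)/andP[|h1 h2].
    by rewrite -addnn; lia.
  by rewrite lerNl h2 lerNr h1.
have Gm : G `<=` measurable by move=> _ [u [v [-> _]]]; exact: measurable_itv.
have GI : setI_closed G.
  move=> _ _ [u [v [-> uv]]] [u' [v' [-> uv']]].
  exists (Num.max u u'), (Num.min v v'); split; first by rewrite capE.
  rewrite !lt_max !gt_min !le_max !ge_min.
  case: uv => [->|[->|[-> ->]]]; [by left|by right; left; rewrite ?orbT|].
  by right; right.
have mG : @measurable _ (measurableTypeR R) = <<s G >>.
  apply/seteqP; split; last first.
    by apply: smallest_sub => //; exact: sigma_algebra_measurable.
  rewrite {1}/measurable /= RGenCInfty.measurableE.
  apply: smallest_sub; first exact: smallest_sigma_algebra.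
  move=> _ [x ->].
  (* The generating ray from [x] to infinity is the countable union of its traces on the [g k], and
     each trace is again in [G]. *)
  rewrite -[X in _ X]setIT -gT setI_bigcupr.
  apply: sigma_algebra_bigcup => k; apply: sub_sigma_algebra.
  have [u [v [-> uv]]] := Gg k.
  exists (Num.max x u), v; split.
    apply/seteqP; split => y /=; rewrite !in_itv /= andbT ge_max.
      by move=> [-> /andP[-> ->]].
    by move=> /andP[/andP[-> ->] ->].
  rewrite lt_max le_max.
  case: uv => [->|[->|[-> ->]]]; rewrite ?orbT; first by left.
  - by right; left.
  - by right; right.
apply: (measure_unique G g) => //.
- move=> _ [u [v [-> [u0|[v0|[u0 v0]]]]]].
  + by apply: m12; left.
  + by apply: m12; right.
  + have [-> | ->] : `[u, v]%classic = set0 \/ `[u, v]%classic = [set 0].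
      have [uv|uv] := leP u v.
        right; have -> : u = 0 by apply/eqP; rewrite eq_le u0 (le_trans uv).
        have -> : v = 0 by apply/eqP; rewrite eq_le v0 (le_trans u0).
        by rewrite set_itv1.
      by left; apply/set_itv_ge; rewrite bnd_simp -ltNge.
    * by rewrite !measure0.
    * exact: m12_0.
- move=> k; apply: le_lt_trans m1oo; apply: le_measure => //; rewrite inE //.
  exact: Gm (Gg k).
Qed.

(** * The Cauchy density under the substitution x = 1/y - 1 *)

Lemma cauchy_pdf_ge0 (R : realType) (a b x : R) :
  0 < a -> 0 <= cauchy_pdf a b x.
Proof.
move=> a0; rewrite /cauchy_pdf mulr_ge0 ?invr_ge0 ?pi_ge0//.
by apply: divr_ge0; [exact: ltW|exact: addr_ge0 (sqr_ge0 _) (sqr_ge0 _)].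
Qed.

Lemma continuous_cauchy_pdf (R : realType) (a b : R) :
  0 < a -> continuous (cauchy_pdf a b).
Proof.
move=> a0 x; apply: cvgM; first exact: cvg_cst.
apply: cvgM; first exact: cvg_cst.
apply: cvgV.
  by rewrite gt_eqF// ltr_wpDl ?sqr_ge0// exprn_gt0.
by apply: cvgD; [apply: cvgM; apply: cvgB => //; exact: cvg_cst|exact: cvg_cst].
Qed.

Lemma measurable_cauchy_pdf (R : realType) (a b : R) : 0 < a ->
  measurable_fun [set: R] (fun x => (cauchy_pdf a b x)%:E).
Proof.
move=> a0; apply/measurable_EFinP; apply: continuous_measurable_fun.
exact: continuous_cauchy_pdf.
Qed.

(** The factor [y ^- 2] is the absolute value of the derivative of 1/y - 1. *)
Lemma cauchy_pdf_inv1D (R : realType) (a b y : R) : 0 < a -> y != 0 ->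
  cauchy_pdf (a / ((1 + b) ^+ 2 + a ^+ 2)) ((b + 1) / ((1 + b) ^+ 2 + a ^+ 2)) y
  = cauchy_pdf a b (y^-1 - 1) * y ^- 2.
Proof.
move=> a0 y0; rewrite /cauchy_pdf -[RHS]mulrA; congr (_ * _).
set D := (1 + b) ^+ 2 + a ^+ 2.
have D0 : 0 < D by rewrite ltr_wpDl ?sqr_ge0// exprn_gt0.
have E0 : 0 < (y^-1 - 1 - b) ^+ 2 + a ^+ 2.
  by rewrite ltr_wpDl ?sqr_ge0// exprn_gt0.
(* Completing the square: y^2 ((1/y - 1 - b)^2 + a^2) = D y^2 - 2 (1 + b) y + 1, whose minimum is at
   (1 + b)/D. This is the source of the new parameters. *)
have -> : (y - (b + 1) / D) ^+ 2 + (a / D) ^+ 2 =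
    ((y^-1 - 1 - b) ^+ 2 + a ^+ 2) * y ^+ 2 / D.
  have D0' := lt0r_neq0 D0; rewrite /D in D0' *; field.
  by rewrite y0 D0'.
have := lt0r_neq0 D0; have := lt0r_neq0 E0.
move: (_ ^+ 2 + a ^+ 2) (D) => E D' E1 D1; field.
by rewrite E1 y0 D1.
Qed.

(** On an interval lying on one side of 0, [F] is decreasing and continuously differentiable, so
    substitution applies with the endpoints swapped. *)
Lemma integral_cauchy_pdf_inv1D (R : realType) (a b u v : R) : 0 < a ->
  0 < u \/ v < 0 -> u <= v ->
  (\int[lebesgue_measure]_(x in `[(v^-1 - 1)%R, (u^-1 - 1)%R])
     (cauchy_pdf a b x)%:E =
  \int[lebesgue_measure]_(x in `[u, v])
     (cauchy_pdf (a / ((1 + b) ^+ 2 + a ^+ 2))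
       ((b + 1) / ((1 + b) ^+ 2 + a ^+ 2)) x)%:E)%E.
Proof.
move=> a0 uv0 uv; pose F (y : R) := y^-1 - 1.
have n0 x : u <= x <= v -> x != 0.
  move=> /andP[ux xv]; case: uv0 => [u0|v0].
    by rewrite gt_eqF// (lt_le_trans u0).
  by rewrite lt_eqF// (le_lt_trans xv).
have dF (x : R) : x != 0 -> is_derive x 1 F (- x ^- 2).
  move=> x0.
  have dV := @is_deriveV _ id x 1 1 x0 (is_derive_id x 1).
  have := is_deriveB dV (is_derive_cst (1 : R) x 1).
  by rewrite subr0 [_ *: _]mulr1.
have F'E (x : R) : x != 0 -> derive1 F x = - x ^- 2.
  by move=> x0; have dx := dF x x0; rewrite derive1E derive_val.
have cF (x : R) : x != 0 -> {for x, continuous F}.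
  move=> x0; apply: differentiable_continuous; apply/derivable1_diffP.
  by have [] := dF x x0.
have cF' (x : R) : x != 0 -> {for x, continuous (derive1 F)}.
  move=> x0.
  have near0 : \forall y \near x, y != 0 by apply: (@open_neq R 0).
  have : (fun y : R => - y ^- 2) @ x --> - x ^- 2.
    apply: cvgN; apply: cvgV; first by rewrite expf_neq0.
    exact: exprn_continuous.
  (* The formula for [derive1 F] holds only off 0, hence on a neighbourhood of [x], which is enough
     to transfer the limit. *)
  move=> h; suff : derive1 F @ x --> - x ^- 2 by rewrite -(F'E x x0).
  apply: cvg_trans h.
  apply: near_eq_cvg; near=> y; rewrite F'E//; near: y.
  exact: near0.
have u0 : u != 0 by apply: n0; rewrite lexx.
have v0 : v != 0 by apply: n0; rewrite lexx uv.
rewrite -[(v^-1 - 1)%R]/(F v) -[(u^-1 - 1)%R]/(F u).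
rewrite integration_by_substitution_decreasing//.
- apply: eq_integral => x; rewrite inE /= in_itv /= => /n0 x0.
  by rewrite cauchy_pdf_inv1D//= !fctE F'E// opprK.
- move=> x y; rewrite !in_itv /= => /[dup] xuv /n0 x0 /[dup] yuv /n0 y0 xy.
  rewrite /F ltrD2r; case: uv0 => [up|vn].
    rewrite ltf_pV2 ?posrE//.
      by case/andP: xuv => + _; exact: lt_le_trans.
    by case/andP: yuv => + _; exact: lt_le_trans.
  rewrite ltf_nV2 ?negrE//.
    by case/andP: xuv => _ /le_lt_trans; apply.
  by case/andP: yuv => _ /le_lt_trans; apply.
- move=> x; rewrite in_itv /= => /andP[ux xv]; apply: cF'.
  by apply: n0; rewrite !ltW.
- apply/cvg_ex; exists (derive1 F u); apply: cvg_at_right_filter; exact: cF'.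
- apply/cvg_ex; exists (derive1 F v); apply: cvg_at_left_filter; exact: cF'.
- split.
  + move=> x; rewrite in_itv /= => /andP[ux xv].
    by have [] := dF x (n0 x _); rewrite ?ltW.
  + by apply: cvg_at_right_filter; exact: cF.
  + by apply: cvg_at_left_filter; exact: cF.
- apply: continuous_subspaceT; exact: continuous_cauchy_pdf.
Unshelve. all: by end_near.
Qed.

(** * From densities to random variables *)

(** Both differences are negligible, so each set has the measure of the intersection. *)
Lemma ae_eq_measure d (T : measurableType d) (R : realType)
    (mu : {measure set T -> \bar R}) (A B : set T) :
  measurable A -> measurable B -> {ae mu, forall x, A x <-> B x} -> mu A = mu B.
Proof.
move=> mA mB AB; rewrite (measureDI mu mA mB) (measureDI mu mB mA) setIC.
congr (_ + _)%E; transitivity (0%E : \bar R).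
  apply: measure_negligible; first exact: measurableD.
  by apply: negligibleS AB => x [Ax nBx] /= [/(_ Ax)].
apply/esym; apply: measure_negligible; first exact: measurableD.
by apply: negligibleS AB => x [Bx nAx] /= [_ /(_ Bx)].
Qed.

Lemma cauchy_inv1D d (T : measurableType d) (R : realType)
    (P : probability T R) (X Y : {RV P >-> R}) (a b : R) :
  cauchy_distributed X a b ->
  {ae P, forall w, 1 + X w != 0 -> Y w = 1 / (1 + X w)} ->
  cauchy_distributed Y (a / ((1 + b) ^+ 2 + a ^+ 2))
    ((b + 1) / ((1 + b) ^+ 2 + a ^+ 2)).
Proof.
move=> [a0 hX] hY; set a' := a / _; set b' := (b + 1) / _.
have a'0 : 0 < a' by rewrite divr_gt0// ltr_wpDl ?sqr_ge0// exprn_gt0.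
have mRV (Z : {RV P >-> R}) (A : set R) : measurable A ->
    measurable (Z @^-1` A).
  by move=> mA; rewrite -[X in measurable X]setTI; exact: measurable_funP.
have Xm1 : {ae P, forall w, 1 + X w != 0}.
  have E : ~` [set w | 1 + X w != 0] = X @^-1` [set -1].
    apply/seteqP; split => w /=.
      by move/negP/negPn; rewrite addrC addr_eq0 => /eqP.
    by move=> ->; rewrite subrr eqxx.
  apply/negligibleP; rewrite /= E; first exact: mRV (measurable_set1 _).
  by rewrite [LHS](hX [set -1])// integral_set1.
have YE : {ae P, forall w, 1 + X w != 0 /\ Y w = (1 + X w)^-1}.
  by apply: filterS2 Xm1 hY => w X0 /(_ X0); rewrite div1r.
split => // A mA.
have [m mE] := lebesgue_density_measure_ex R _
  (measurable_cauchy_pdf R a' b' a'0) (fun x => cauchy_pdf_ge0 R a' b' x a'0).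
rewrite -mE; apply: (@eq_measure_itv_off0 R (distribution P Y) m) mA.
- by rewrite (le_lt_trans (probability_le1 _ _)) ?ltry.
(* Both measures vanish on {0}: a density does not charge a point, and [Y] is almost surely the
   inverse of a nonzero number. *)
- rewrite mE integral_set1 -(measure0 P) /distribution /pushforward /=.
  apply: (ae_eq_measure _ _ _ P) => //.
  apply: filterS YE => w [X0 YX] /=; split => //.
  by rewrite YX => /eqP; rewrite invr_eq0 (negbTE X0).
- move=> u v uv0; rewrite mE.
  have [uv|uv] := leP u v; last first.
    by rewrite set_itv_ge ?integral_set0 ?measure0// bnd_simp -ltNge.
  rewrite -integral_cauchy_pdf_inv1D// -hX// /distribution /pushforward /=.
  apply: (ae_eq_measure _ _ _ P).
  - exact: mRV _ _ (measurable_itv _).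
  - exact: mRV _ _ (measurable_itv _).
  apply: filterS YE => w [X0 YX] /=; rewrite YX !in_itv /=.
  rewrite lerBrDl lerBlDl.
  move: (1 + X w) X0 => x x0.
  (* With [x] standing for [1 + X w]: if [x] has the sign of the interval, inversion reverses the
     order and the two conditions agree; otherwise both are false. *)
  case: uv0 => [u0|v0].
    have v0 := lt_le_trans u0 uv.
    have [x_gt0|x_le0] := ltrP 0 x.
      by rewrite invf_pge ?posrE// invf_ple ?posrE// andbC.
    rewrite (lt_geF (le_lt_trans _ u0)) ?invr_le0//.
    by rewrite (lt_geF (le_lt_trans x_le0 _)) ?invr_gt0.
  have u0 := le_lt_trans uv v0.
  have [x_lt0|x_ge0] := ltrP x 0.
    by rewrite invf_nge ?negrE// invf_nle ?negrE// andbC.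
  rewrite (lt_geF (lt_le_trans v0 _)) ?invr_ge0// andbF.
  by rewrite (lt_geF (lt_le_trans _ x_ge0)) ?invr_lt0// andbF.
Qed.

Theorem theorem4p1 (d : measure_display) (T : measurableType d) (R : realType)
    (P : probability T R) (C : {RV P >-> R}) (V : nat -> {RV P >-> R})
    (hC : cauchy_distributed C 1 0) (hV : continued_fraction_rv C V) :
  exists a b : nat -> R,
    (forall n : nat, (1 <= n)%N -> cauchy_distributed (V n) (a n) (b n)) /\
    (forall n : nat, (1 <= n)%N ->
       a n.+1 = a n / ((1 + b n) ^+ 2 + a n ^+ 2) /\
       b n.+1 = (b n + 1) / ((1 + b n) ^+ 2 + a n ^+ 2)).
Proof.
pose step (p : R * R) := (p.1 / ((1 + p.2) ^+ 2 + p.1 ^+ 2),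
  (p.2 + 1) / ((1 + p.2) ^+ 2 + p.1 ^+ 2)).
(* Index 0 carries the parameters of [C], not of [V 0]; one step then gives those of [V 1], and the
   recursion holds by computation. *)
pose s n := iter n step (1, 0).
exists (fun n => (s n).1), (fun n => (s n).2); split => // -[//|n _].
elim: n => [|n IHn].
  exact: cauchy_inv1D hC hV.1.
exact: cauchy_inv1D IHn (hV.2 n.+1 isT).
Qed.
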